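(* Let $X\in\mathcal S^n$, $y\in\mathbb R^m$, $\eta>1$, and put $S=C-\sum_{i=1}^my_iA_i$ and $\bar b_i=b_i-A_i\bullet X$ for $i=1,\dots,m$. Consider the refining problems $$(\bar P)\quad\min_{\bar X\in\mathcal S^n}\left\{\eta S\bullet\bar X:\ A_i\bullet\bar X=\eta\bar b_i\ (i=1,\dots,m),\ \bar X\succeq-\eta X\right\},$$ $$(\bar D)\quad\max_{(\bar y,\bar S)\in\mathbb R^m\times\mathcal S^n}\left\{\eta\bar b^\top\bar y-\eta X\bullet\bar S:\ \sum_{i=1}^m\bar y_iA_i+\bar S=\eta S,\ \bar S\succeq0\right\}.$$ If $(\bar X,\bar y,\bar S)$ is an $\epsilon$-precise solution of the refining problems $(\bar P)$ and $(\bar D)$, then $X+\frac1\eta\bar X$ and $y+\frac1\eta\bar y$ (with slack matrix $C-\sum_i(y_i+\frac1\eta\bar y_i)A_i$) form an $\frac\epsilon\eta$-precise solution of the original SDO problem.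
   Context: $\mathcal S^n$ is the space of real symmetric $n\times n$ matrices, $U\bullet V=\mathrm{tr}(UV)$, $\succeq$ is the Löwner order, and $e_{\min}(A)$ is the smallest eigenvalue of $A$. The original SDO problem, with data $b\in\mathbb R^m$, $C,A_1,\dots,A_m\in\mathcal S^n$ ($A_i$ linearly independent), is the pair $\inf_X\{C\bullet X:A_i\bullet X=b_i\ (i\le m),X\succeq0\}$ and $\sup_{y,S}\{b^\top y:\sum_iy_iA_i+S=C,S\succeq0\}$; strong duality (zero duality gap) is assumed to hold. $\epsilon>0$. For the original problem, $(X,y,S)\in\mathcal S^n\times\mathbb R^m\times\mathcal S^n$ is $\epsilon$-precise if $e_{\min}(X)\ge-\epsilon$, $e_{\min}(S)\ge-\epsilon$, $S=C-\sum_iy_iA_i$, $\max_i|b_i-A_i\bullet X|\le\epsilon$ and $X\bullet S\le\epsilon$. Correspondingly, $(\bar X,\bar y,\bar S)$ is $\epsilon$-precise for the refining problems if $e_{\min}(\bar X+\eta X)\ge-\epsilon$, $\bar S=\eta S-\sum_i\bar y_iA_i$, $e_{\min}(\bar S)\ge-\epsilon$, $|\eta\bar b_i-A_i\bullet\bar X|\le\epsilon$ for all $i$, and $(\bar X+\eta X)\bullet\bar S\le\epsilon$. *)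

(* Defs.v *)
From HB Require Import structures.
From mathcomp Require Import all_boot all_order all_algebra.
From mathcomp Require Import sesquilinear spectral polyrcf complex.
From mathcomp Require Import all_classical all_reals ereal.

Set Implicit Arguments.
Unset Strict Implicit.
Unset Printing Implicit Defensive.

Import Order.TTheory GRing.Theory Num.Theory.
Local Open Scope classical_set_scope.
Local Open Scope ring_scope.

Definition mxdot (R : realType) (n : nat) (U V : 'M[R]_n) : R := \tr (U *m V).

Notation "U '•' V" := (mxdot U V) (at level 40, left associativity) : ring_scope.

Definition psd (R : realType) (n : nat) (A : 'M[R]_n) : Prop :=
  A \is symmetricmx /\ forall v : 'rV[R]_n, 0 <= (v *m A *m v^T) 0 0.

Definition loewner_ge (R : realType) (n : nat) (U V : 'M[R]_n) : Prop :=
  psd (U - V).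

Notation "U '⪰' V" := (loewner_ge U V) (at level 70, no associativity) : ring_scope.

(* For symmetric A and n > 0 the infimum is attained, see [e_minP] below;
   for n = 0 there is no eigenvalue and the value is inf set0 = 0. *)
Definition e_min (R : realType) (n : nat) (A : 'M[R]_n) : R :=
  inf [set a : R | eigenvalue A a].

(* The primal-dual pair
     inf_X      { C • X : A_i • X = b_i, X ⪰ L }
     sup_(y, S) { b^T y + L • S : sum_i y_i A_i + S = C, S ⪰ 0 },
   of which the original problem (L = 0) and the refining problems
   (L = - eta X) are instances. *)
Record sdo (R : realType) (m n : nat) := SDO {
  sdo_cost : 'M[R]_n;
  sdo_mx : 'I_m -> 'M[R]_n;
  sdo_rhs : 'cV[R]_m;
  sdo_lower : 'M[R]_n }.

Section sdo_theory.
Variables (R : realType) (m n : nat).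
Implicit Types (P : sdo R m n) (X S : 'M[R]_n) (y : 'cV[R]_m).

Definition primal_objective P X : R := sdo_cost P • X.

Definition primal_feasible P X : Prop :=
  [/\ X \is symmetricmx,
      forall i, sdo_mx P i • X = sdo_rhs P i 0
    & X ⪰ sdo_lower P].

Definition dual_objective P y S : R :=
  ((sdo_rhs P)^T *m y) 0 0 + sdo_lower P • S.

Definition dual_feasible P y S : Prop :=
  [/\ S \is symmetricmx,
      \sum_i y i 0 *: sdo_mx P i + S = sdo_cost P
    & S ⪰ 0].

Definition primal_value P : \bar R :=
  ereal_inf [set (primal_objective P X)%:E | X in [set X | primal_feasible P X]].

Definition dual_value P : \bar R :=
  ereal_sup [set (dual_objective P z.1 z.2)%:E
            | z in [set z : 'cV[R]_m * 'M[R]_n | dual_feasible P z.1 z.2]].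

(* An equality of extended reals; in particular it excludes that both
   problems are infeasible (+oo versus -oo). *)
Definition strong_duality P : Prop := primal_value P = dual_value P.

Definition eps_precise P (eps : R) X y S : Prop :=
  X \is symmetricmx /\ S \is symmetricmx /\
  [/\ - eps <= e_min (X - sdo_lower P),
      - eps <= e_min S,
      S = sdo_cost P - \sum_i y i 0 *: sdo_mx P i,
      forall i, `|sdo_rhs P i 0 - sdo_mx P i • X| <= eps
    & (X - sdo_lower P) • S <= eps].

Definition original_sdo (C : 'M[R]_n) (A : 'I_m -> 'M[R]_n) (b : 'cV[R]_m)
  : sdo R m n := SDO C A b 0.

Definition refining_sdo (eta : R) (A : 'I_m -> 'M[R]_n) (S : 'M[R]_n)
    (bbar : 'cV[R]_m) (X : 'M[R]_n) : sdo R m n :=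
  SDO (eta *: S) A (eta *: bbar) (- (eta *: X)).

Lemma original_eps_preciseE C A b eps X y S : 0 <= eps ->
  eps_precise (original_sdo C A b) eps X y S <->
  X \is symmetricmx /\ S \is symmetricmx /\
  [/\ - eps <= e_min X,
      - eps <= e_min S,
      S = C - \sum_i y i 0 *: A i,
      \big[Num.max/0]_i `|b i 0 - A i • X| <= eps
    & X • S <= eps].
Proof.
move=> eps0; rewrite /eps_precise /= subr0.
split=> -[hX [hS [h1 h2 h3 h4 h5]]]; do 2!split=> //; split=> //.
  exact: bigmax_le.
by move=> i; apply: le_trans h4; apply: le_bigmax.
Qed.

Lemma refining_eps_preciseE eta A S bbar X eps Xb yb Sb :
  eps_precise (refining_sdo eta A S bbar X) eps Xb yb Sb <->
  Xb \is symmetricmx /\ Sb \is symmetricmx /\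
  [/\ - eps <= e_min (Xb + eta *: X),
      - eps <= e_min Sb,
      Sb = eta *: S - \sum_i yb i 0 *: A i,
      forall i, `|eta * bbar i 0 - A i • Xb| <= eps
    & (Xb + eta *: X) • Sb <= eps].
Proof.
rewrite /eps_precise /= opprK.
by split=> -[hX [hS [h1 h2 h3 h4 h5]]]; do 2!split=> //; split=> // i;
  have := h4 i; rewrite mxE.
Qed.

End sdo_theory.

Section e_min_theory.
Variable R : realType.

Lemma symmetric_eigenvalue n (A : 'M[R]_n) : (0 < n)%N ->
  A \is symmetricmx -> exists a, eigenvalue A a.
Proof.
case: n A => // n A _ /is_hermitianmxP; rewrite expr0 scale1r map_mx_id // => sA.
pose Ac := map_mx (real_complex R) A.
have hAc : Ac \is hermsymmx.
  apply/is_hermitianmxP; rewrite expr0 scale1r; apply/matrixP => i j.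
  rewrite !mxE [in LHS]sA mxE /=; apply/esym/CrealP.
  by rewrite complex_real.
have nAc := hermitian_normalmx hAc.
pose P := spectralmx Ac; pose d := spectral_diag Ac.
have Pu : P \in unitmx by apply: unitarymx_unit; exact: spectral_unitarymx.
have PA : P *m Ac = diag_mx d *m P.
  by rewrite {1}(orthomx_spectralP nAc) !mulmxA mulmxV // mul1mx.
have /complex_realP[a ad] : d 0 0 \is Num.real.
  by have /mxOverP := hermitian_spectral_diag_real hAc; exact.
exists a; rewrite eigenvalue_root_char.
rewrite -(fmorph_root (real_complex R)) map_char_poly -eigenvalue_root_char.
apply/eigenvalueP; exists (row 0 P).
  rewrite -row_mul PA; apply/rowP => j; rewrite !mxE (bigD1 0) //= big1.
    by rewrite !mxE eqxx mulr1n addr0 -ad.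
  by move=> k k0; rewrite !mxE eq_sym (negbTE k0) mulr0n mul0r.
apply/eqP => r0; have := row_free_unit P; rewrite Pu => /row_freeP[Q PQ].
have /rowP/(_ 0) : row 0 P *m Q = row 0 1%:M by rewrite -row_mul PQ.
by rewrite r0 mul0mx !mxE eqxx => /eqP; rewrite eq_sym oner_eq0.
Qed.

Lemma e_minP n (A : 'M[R]_n) : (0 < n)%N -> A \is symmetricmx ->
  eigenvalue A (e_min A) /\ forall a, eigenvalue A a -> e_min A <= a.
Proof.
move=> n0 sA; have [a0 ea0] := symmetric_eigenvalue n0 sA.
have p0 : char_poly A != 0 by apply: monic_neq0; exact: char_poly_monic.
have mem_rs a : eigenvalue A a = (a \in rootsR (char_poly A)).
  by rewrite eigenvalue_root_char -roots_on_rootsR // in_itv.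
have : sorted <=%R (sort <=%R (rootsR (char_poly A))) by exact: sort_le_sorted.
have mem_sort_rs a : eigenvalue A a = (a \in sort <=%R (rootsR (char_poly A))).
  by rewrite mem_sort.
move: ea0; rewrite mem_sort_rs.
case: (sort _ _) mem_sort_rs => // r s mem_s _ /=.
rewrite (path_sortedE le_trans) => /andP[/allP le_r _].
have lb_r a : eigenvalue A a -> r <= a.
  by rewrite mem_s inE => /predU1P[->//|/le_r].
have er : eigenvalue A r by rewrite mem_s mem_head.
suff -> : e_min A = r by [].
apply/eqP; rewrite eq_le; apply/andP; split.
  by apply: ge_inf => //; exists r => a /lb_r.
by apply: lb_le_inf; [exists r | move=> a /lb_r].
Qed.

End e_min_theory.

(* Main.v *)
Require Import Defs.
From mathcomp Require Import all_boot all_order all_algebra sesquilinear.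
From mathcomp Require Import all_classical all_reals.

Import Order.TTheory GRing.Theory Num.Theory.
Local Open Scope ring_scope.

(** The refining problems are the original problem translated to the base
    point [(X, y)] and magnified by [eta].  Undoing this change of variables,
    [X + eta^-1 Xb = eta^-1 (Xb + eta X)] and the slack matrix of
    [y + eta^-1 yb] is [eta^-1 Sb], while the residual of each equality
    constraint is [eta^-1] times the residual in the refining problem.  The
    residual bounds therefore shrink by the factor [eta], and so do the two
    eigenvalue bounds because [e_min] is positively homogeneous on symmetric
    matrices ([e_minZ]).  The complementarity term is bilinear and shrinks
    even by [eta ^ 2], hence by [eta], since [eta > 1] and its bound [eps] is
    nonnegative. *)

Lemma eigenvalueZ (F : fieldType) (n : nat) (c : F) (M : 'M[F]_n) (a : F) :
  eigenvalue M a -> eigenvalue (c *: M) (c * a).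
Proof.
move=> /eigenvalueP[v vM v0]; apply/eigenvalueP; exists v => //.
by rewrite -scalemxAr vM scalerA.
Qed.

Lemma symmetricmxP (F : fieldType) (n : nat) (M : 'M[F]_n) :
  reflect (M^T = M) (M \is symmetricmx).
Proof.
by apply: (iffP (is_hermitianmxP _ _ _)); rewrite expr0 scale1r map_mx_id.
Qed.

Lemma symmetricmxD (F : fieldType) (n : nat) (M N : 'M[F]_n) :
  M \is symmetricmx -> N \is symmetricmx -> M + N \is symmetricmx.
Proof.
move=> /symmetricmxP sM /symmetricmxP sN; apply/symmetricmxP.
by rewrite linearD /= sM sN.
Qed.

Lemma symmetricmxZ (F : fieldType) (n : nat) (c : F) (M : 'M[F]_n) :
  M \is symmetricmx -> c *: M \is symmetricmx.
Proof.
by move=> /symmetricmxP sM; apply/symmetricmxP; rewrite linearZ /= sM.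
Qed.

(** Scaling by [c] maps the spectrum of [M] into that of [c *: M], and scaling
    by [c^-1] maps it back.  In positive dimension symmetry makes both
    minima attained, so each is bounded by a scaled copy of the other. *)
Lemma e_minZ (R : realType) (n : nat) (c : R) (M : 'M[R]_n) :
  M \is symmetricmx -> 0 < c -> e_min (c *: M) = c * e_min M.
Proof.
move=> sM c0; have [n0|n0] := posnP n.
  (* There is no eigenvalue in dimension 0, so both sides are the infimum of
     the empty set. *)
  have e0 (N : 'M[R]_n) : e_min N = 0.
    rewrite /e_min (_ : [set a | eigenvalue N a]%classic = set0) ?inf0 //.
    rewrite -subset0 => a /eigenvalueP[v _ /eqP[]].
    by subst n; exact: thinmx0.
  by rewrite !e0 mulr0.
have scM : c *: M \is symmetricmx by exact: symmetricmxZ.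
have [eM leM] := e_minP n0 sM; have [ecM lecM] := e_minP n0 scM.
apply/eqP; rewrite eq_le lecM ?eigenvalueZ //=.
rewrite -ler_pdivlMl //; apply: leM.
by have := eigenvalueZ _ _ c^-1 _ _ ecM; rewrite scalerA mulVf ?gt_eqF // scale1r.
Qed.

Lemma mxdotDr (R : realType) (n : nat) (U V W : 'M[R]_n) :
  U • (V + W) = U • V + U • W.
Proof. by rewrite /mxdot mulmxDr mxtraceD. Qed.

Lemma mxdotZl (R : realType) (n : nat) (c : R) (U V : 'M[R]_n) :
  (c *: U) • V = c * (U • V).
Proof. by rewrite /mxdot -scalemxAl mxtraceZ. Qed.

Lemma mxdotZr (R : realType) (n : nat) (c : R) (U V : 'M[R]_n) :
  U • (c *: V) = c * (U • V).
Proof. by rewrite /mxdot -scalemxAr mxtraceZ. Qed.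

Theorem theorem8 (R : realType) (m n : nat)
    (C : 'M[R]_n) (A : 'I_m -> 'M[R]_n) (b : 'cV[R]_m) (eps : R)
    (C_sym : C \is symmetricmx) (A_sym : forall i, A i \is symmetricmx)
    (A_free : free [seq A i | i : 'I_m])
    (zero_gap : strong_duality (original_sdo C A b))
    (eps_gt0 : 0 < eps)
    (X : 'M[R]_n) (y : 'cV[R]_m) (eta : R) (S : 'M[R]_n) (bbar : 'cV[R]_m)
    (X_sym : X \is symmetricmx) (eta_gt1 : 1 < eta)
    (S_def : S = C - \sum_i y i 0 *: A i)
    (bbar_def : forall i, bbar i 0 = b i 0 - A i • X)
    (Xb : 'M[R]_n) (yb : 'cV[R]_m) (Sb : 'M[R]_n) :
  eps_precise (refining_sdo eta A S bbar X) eps Xb yb Sb ->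
  eps_precise (original_sdo C A b) (eps / eta)
    (X + eta^-1 *: Xb) (y + eta^-1 *: yb)
    (C - \sum_i (y i 0 + eta^-1 * yb i 0) *: A i).
Proof.
move=> /refining_eps_preciseE[sXb [sSb [eX eS Sb_def res compl]]].
have eta0 : 0 < eta by exact: lt_trans ltr01 eta_gt1.
have etaV0 : 0 < eta^-1 by rewrite invr_gt0.
have etaN0 : eta != 0 by rewrite gt_eqF.
have X_scaled : X + eta^-1 *: Xb = eta^-1 *: (Xb + eta *: X).
  by rewrite scalerDr scalerA mulVf // scale1r addrC.
have S_scaled : C - \sum_i (y i 0 + eta^-1 * yb i 0) *: A i = eta^-1 *: Sb.
  rewrite Sb_def S_def scalerBr scalerA mulVf // scale1r -addrA -opprD.
  rewrite scaler_sumr -big_split /=; congr (_ - _); apply: eq_bigr => i _.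
  by rewrite scalerDl scalerA.
have scaled_bound t : - eps <= t -> - (eps / eta) <= eta^-1 * t.
  by move=> et; rewrite -mulNr mulrC ler_pM2l.
have sXeX : Xb + eta *: X \is symmetricmx by rewrite symmetricmxD // symmetricmxZ.
rewrite /eps_precise /= subr0 S_scaled X_scaled; split; first exact: symmetricmxZ.
split; first exact: symmetricmxZ; split.
- by rewrite e_minZ // scaled_bound.
- by rewrite e_minZ // scaled_bound.
- by rewrite -S_scaled; congr (_ - _); apply: eq_bigr => i _; rewrite !mxE.
- move=> i; rewrite -X_scaled mxdotDr mxdotZr opprD addrA -bbar_def.
  have -> : bbar i 0 - eta^-1 * (A i • Xb)
          = eta^-1 * (eta * bbar i 0 - A i • Xb).
    by rewrite mulrBr mulrA mulVf // mul1r.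
  by rewrite normrM gtr0_norm // mulrC ler_pM2r.
  (* Of the two factors [eta^-1] from bilinearity, one gives the bound and the
     other is absorbed as [eta^-1 <= 1], which needs [0 <= eps]. *)
- rewrite mxdotZl mxdotZr [leRHS]mulrC ler_pM2l //.
  apply: (@le_trans _ _ (eta^-1 * eps)); first by rewrite ler_pM2l.
  by rewrite ler_piMl ?ltW // invf_lt1.
Qed.
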